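(* Let $G$ be a subgroup of the affine group $\mathcal G$ with a unitary representation $G\ni g\mapsto U_g$ on a separable Hilbert space, and let $\dot A$ be a $G$-invariant closed densely defined symmetric operator with deficiency indices $(1,1)$. Suppose that $\dot A$ has either (i) at least three different self-adjoint $G$-invariant extensions, or (ii) at least two $G$-invariant maximal dissipative extensions, one of which is not self-adjoint. Then every maximal dissipative extension $A$ of $\dot A$ with $\dot A\subset A\subset(\dot A)^*$ is $G$-invariant. Moreover, in this case, if the group $G$ is nontrivial, then $\dot A$ is not semi-bounded.
   Context: $\mathcal G$ is the group (under composition) of affine maps $g(x)=ax+b$ of $\mathbb R$ with $a>0$, $b\in\mathbb R$; for an operator $A$, $g(A)=aA+bI$. A densely defined closed operator $A$ is $G$-invariant (with respect to $g\mapsto U_g$) if $U_g(\mathrm{Dom}(A))=\mathrm{Dom}(A)$ and $U_gAU_g^*f=aAf+bf$ for all $f\in\mathrm{Dom}(A)$ and all $g\in G$. An operator is maximal dissipative if $\operatorname{Im}(Af,f)\ge0$ on its domain and it has no proper dissipative extension. Extensions of $\dot A$ are understood as operators $A$ with $\dot A\subset A\subset(\dot A)^*$. *)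

(* Defs.v *)
From HB Require Import structures.
From mathcomp Require Import all_boot all_order all_algebra.
From mathcomp Require Import classical_sets reals.
From mathcomp Require Import complex.
Set Implicit Arguments. Unset Strict Implicit. Unset Printing Implicit Defensive.
Import Order.TTheory GRing.Theory Num.Theory.
Local Open Scope ring_scope.
Local Open Scope classical_set_scope.

Section Hilbert.
Variables (R : realType) (H : lmodType R[i]) (ip : H -> H -> R[i]).

Definition inner_product : Prop :=
  [/\ (forall (c : R[i]) x y z, ip (c *: x + y) z = c * ip x z + ip y z),
      (forall x y, ip x y = conjc (ip y x)),
      (forall x, 0 <= complex.Re (ip x x)) &
      (forall x, ip x x = 0 -> x = 0)].

Definition hnorm (x : H) : R := Num.sqrt (complex.Re (ip x x)).

Definition converges (u : nat -> H) (x : H) : Prop :=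
  forall eps : R, 0 < eps -> exists N, forall n, (N <= n)%N -> hnorm (u n - x) < eps.

Definition cauchy (u : nat -> H) : Prop :=
  forall eps : R, 0 < eps -> exists N, forall n m, (N <= n)%N -> (N <= m)%N ->
    hnorm (u n - u m) < eps.

Definition separable_hilbert : Prop :=
  [/\ inner_product,
      (forall u, cauchy u -> exists x, converges u x) &
      (exists d : nat -> H, forall x (eps : R), 0 < eps ->
         exists n, hnorm (x - d n) < eps)].

(** (possibly unbounded) operators are identified with their graphs *)
Definition operator := set (H * H).

Definition dom (A : operator) : set H := [set f | exists h, A (f, h)].

Definition is_operator (A : operator) : Prop :=
  [/\ A (0, 0),
      (forall (c : R[i]) p q, A p -> A q -> A (c *: p.1 + q.1, c *: p.2 + q.2)) &
      (forall h, A (0, h) -> h = 0)].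

Definition densely_defined (A : operator) : Prop :=
  forall x (eps : R), 0 < eps -> exists f, dom A f /\ hnorm (x - f) < eps.

Definition closed_op (A : operator) : Prop :=
  forall (u v : nat -> H) f h, (forall n, A (u n, v n)) ->
    converges u f -> converges v h -> A (f, h).

Definition adjoint (A : operator) : operator :=
  [set p | forall q, A q -> ip q.2 p.1 = ip q.1 p.2].

Definition symmetric_op (A : operator) : Prop :=
  is_operator A /\ densely_defined A /\ A `<=` adjoint A.

Definition self_adjoint (A : operator) : Prop := A = adjoint A.

Definition dim_one (S : set H) : Prop :=
  exists v, S v /\ v <> 0 /\ forall w, S w <-> exists c : R[i], w = c *: v.

Definition deficiency_indices_11 (A : operator) : Prop :=
  dim_one [set f | adjoint A (f, 'i%C *: f)] /\
  dim_one [set f | adjoint A (f, - ('i%C *: f))].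

Definition extension (Ad A : operator) : Prop := Ad `<=` A /\ A `<=` adjoint Ad.

Definition dissipative (A : operator) : Prop :=
  forall f h, A (f, h) -> 0 <= complex.Im (ip h f).

Definition maximal_dissipative (A : operator) : Prop :=
  is_operator A /\ dissipative A /\
  forall B : operator, is_operator B -> dissipative B -> A `<=` B -> B = A.

Definition semibounded (A : operator) : Prop :=
  (exists c : R, forall f h, A (f, h) -> c * hnorm f ^+ 2 <= complex.Re (ip h f)) \/
  (exists c : R, forall f h, A (f, h) -> complex.Re (ip h f) <= c * hnorm f ^+ 2).

(** affine maps x |-> a x + b (a > 0) are encoded as pairs (a, b) *)
Definition aff_comp (g k : R * R) : R * R := (g.1 * k.1, g.1 * k.2 + g.2).
Definition aff_inv (g : R * R) : R * R := (g.1^-1, - (g.2 / g.1)).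

Definition affine_subgroup (G : set (R * R)) : Prop :=
  [/\ (forall g, G g -> 0 < g.1),
      G (1, 0),
      (forall g k, G g -> G k -> G (aff_comp g k)) &
      (forall g, G g -> G (aff_inv g))].

Definition nontrivial_group (G : set (R * R)) : Prop :=
  exists g, G g /\ g <> (1, 0).

Definition unitary_rep (G : set (R * R)) (U : R * R -> H -> H) : Prop :=
  [/\ (forall g, G g -> forall (c : R[i]) x y, U g (c *: x + y) = c *: U g x + U g y),
      (forall g, G g -> forall x y, ip (U g x) (U g y) = ip x y),
      (forall g, G g -> forall y, exists x, U g x = y) &
      (forall g k, G g -> G k -> forall x, U (aff_comp g k) x = U g (U k x))].

(** G-invariance: U_g(Dom A) = Dom A and U_g A U_g^* f = a A f + b f on Dom A.
    Since U_g is unitary, U_g^* f is the unique f' with U_g f' = f. *)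
Definition G_invariant (G : set (R * R)) (U : R * R -> H -> H) (A : operator) : Prop :=
  forall g, G g ->
    U g @` dom A = dom A /\
    forall f h, A (f, h) -> forall f', U g f' = f ->
      exists h', A (f', h') /\ U g h' = ((g.1)%:C)%C *: h + ((g.2)%:C)%C *: f.

End Hilbert.

(* Main.v *)
(* By von Neumann's formula [Ad^*/Ad] is two-dimensional, extensions of [Ad] are its
   subspaces, and each [g] in [G] acts on it linearly, multiplying the boundary form
   (Ad^* f, f') - (f, Ad^* f') by a positive factor. Invariant extensions are lines fixed
   by this action. Once three distinct lines are fixed the action is scalar, so every
   extension is invariant. In case (ii) the third line is the adjoint of the
   non-self-adjoint extension.

   If [Ad] were bounded below by [m], pick a real [l < m] whose image under a nontrivial
   [g] is also below [m] and different from [l]. There is [e <> 0] with [Ad^* e = l e]; the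
   extension of [Ad] by [e] is symmetric and invariant, hence has a second eigenvector
   [e'] with eigenvalue below [m], orthogonal to [e]. Some nonzero combination of [e] and
   [e'] lies in the domain of [Ad], where the quadratic form is then too small. *)
Require Import Defs.
From HB Require Import structures.
From mathcomp Require Import all_boot all_order all_algebra.
From mathcomp Require Import boolp classical_sets reals.
From mathcomp Require Import complex.
From mathcomp Require Import ring lra.
Set Implicit Arguments. Unset Strict Implicit. Unset Printing Implicit Defensive.
Import Order.TTheory GRing.Theory Num.Theory.
Local Open Scope ring_scope.
Local Open Scope classical_set_scope.

(** * Linear identities in modules, by reflection *)

(* [ring] does not decide linear identities in modules, hence the tactic [lmod] below. *)
Inductive lexpr (F : Type) :=
  | LAtom of nat | LZero | LAdd of lexpr F & lexpr F | LOpp of lexpr F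
  | LScale of F & lexpr F.
Arguments LAtom {F}.
Arguments LZero {F}.

Section LinearExpressions.
Variables (F : comNzRingType) (V : lmodType F).

Fixpoint leval (env : seq V) (e : lexpr F) : V :=
  match e with
  | LAtom i => env`_i
  | LZero => 0
  | LAdd e1 e2 => leval env e1 + leval env e2
  | LOpp e1 => - leval env e1
  | LScale c e1 => c *: leval env e1
  end.

Fixpoint lcoef (e : lexpr F) (i : nat) : F :=
  match e with
  | LAtom j => if i == j then 1 else 0
  | LZero => 0
  | LAdd e1 e2 => lcoef e1 i + lcoef e2 i
  | LOpp e1 => - lcoef e1 i
  | LScale c e1 => c * lcoef e1 i
  end.

Lemma leval_sum env e :
  leval env e = \sum_(i < size env) lcoef e i *: env`_i.
Proof.
elim: e => [j||e1 IH1 e2 IH2|e1 IH1|c e1 IH1] /=.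
- have [lt|ge] := ltnP j (size env).
    rewrite (bigD1 (Ordinal lt)) //= eqxx scale1r big1 ?addr0 // => i /eqP ne.
    case: eqP => [eq|_]; last by rewrite scale0r.
    by case: ne; apply: val_inj.
  rewrite nth_default // big1 // => i _; case: eqP => [eq|_]; last by rewrite scale0r.
  by have := ltn_ord i; rewrite eq ltnNge ge.
- by rewrite big1 // => i _; rewrite scale0r.
- by rewrite IH1 IH2 -big_split; apply: eq_bigr => i _; rewrite scalerDl.
- by rewrite IH1 -sumrN; apply: eq_bigr => i _; rewrite scaleNr.
- by rewrite IH1 scaler_sumr; apply: eq_bigr => i _; rewrite scalerA.
Qed.

(** Comparing coefficients atom by atom leaves identities between scalars, which [ring] can settle.
    The [foldr] over [iota] computes to a finite conjunction once the list of atoms is explicit. *)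
Lemma leval_eq env e1 e2 :
  foldr (fun i P => lcoef e1 i = lcoef e2 i /\ P) True (iota 0 (size env)) ->
  leval env e1 = leval env e2.
Proof.
move=> h; rewrite !leval_sum; apply: eq_bigr => i _; congr (_ *: _).
have : (i : nat) \in iota 0 (size env) by rewrite mem_iota ltn_ord.
elim: (iota 0 (size env)) h => [//|j s IH] /= [h1 h2].
by rewrite inE => /orP[/eqP -> //|]; exact: IH.
Qed.

End LinearExpressions.

(* Atoms are compared up to conversion: the two sides of a goal often type the same
   projection of a pair through different structures. *)
Ltac lmod_index v env :=
  lazymatch env with
  | cons ?w ?env' =>
      match goal with
      | _ => let _ := match goal with _ => unify v w end in constr:(O)
      | _ => let i := lmod_index v env' in constr:(S i)
      end
  end.
Ltac lmod_mem v env :=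
  lazymatch env with
  | cons ?w ?env' =>
      match goal with
      | _ => let _ := match goal with _ => unify v w end in constr:(true)
      | _ => lmod_mem v env'
      end
  | _ => constr:(false)
  end.
Ltac lmod_env t env :=
  lazymatch t with
  | GRing.add ?a ?b => let env' := lmod_env a env in lmod_env b env'
  | GRing.opp ?a => lmod_env a env
  | GRing.scale _ ?a => lmod_env a env
  | GRing.zero => env
  | ?v => lazymatch lmod_mem v env with
          | true => env
          | false => constr:(cons v env)
          end
  end.
Ltac lmod_reify F t env :=
  lazymatch t with
  | GRing.add ?a ?b =>
      let a' := lmod_reify F a env in let b' := lmod_reify F b env in
      constr:(@LAdd F a' b')
  | GRing.opp ?a => let a' := lmod_reify F a env in constr:(@LOpp F a')
  | GRing.scale ?c ?a => let a' := lmod_reify F a env in constr:(@LScale F c a')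
  | GRing.zero => constr:(@LZero F)
  | ?v => let i := lmod_index v env in constr:(@LAtom F i)
  end.
Ltac lmod F :=
  lazymatch goal with
  | |- @eq ?V ?s ?t =>
      let env := lmod_env s (@nil V) in let env := lmod_env t env in
      let s' := lmod_reify F s env in let t' := lmod_reify F t env in
      apply: (@leval_eq _ _ env s' t'); rewrite /=; repeat split; ring
  end.


(** * Subspaces between [N] and [M] when the quotient is at most two-dimensional *)

Definition linear_set (F : fieldType) (V : lmodType F) (L : set V) : Prop :=
  L 0 /\ forall (c : F) p q, L p -> L q -> L (c *: p + q).

(** With [N] the graph of a symmetric operator and [M] that of its adjoint, these are the linear
    extensions. *)
Definition intermediate (F : fieldType) (V : lmodType F) (N M L : set V) : Prop :=
  [/\ linear_set L, N `<=` L & L `<=` M].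

Section IntermediateSubspaces.
Variables (F : fieldType) (V : lmodType F).
Implicit Types (L : set V) (x y : V).

Lemma linear_setZ L c x : linear_set L -> L x -> L (c *: x).
Proof. by move=> [L0 Ll] Lx; rewrite -[_ *: _]addr0; exact: Ll. Qed.

Lemma linear_setD L x y : linear_set L -> L x -> L y -> L (x + y).
Proof. by move=> [_ Ll] Lx Ly; rewrite -[x]scale1r; exact: Ll. Qed.

Lemma linear_setB L x y : linear_set L -> L x -> L y -> L (x - y).
Proof.
by move=> HL Lx Ly; apply: linear_setD => //; rewrite -scaleN1r; exact: linear_setZ.
Qed.

Lemma linear_setZK L c x : linear_set L -> c != 0 -> L (c *: x) -> L x.
Proof.
by move=> HL c0 Lx; rewrite -[x]scale1r -(mulVf c0) -scalerA; exact: linear_setZ.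
Qed.

Variables (N M : set V) (HN : linear_set N).

(** Bounds the dimension of [M / N] by two without forming the quotient. *)
Definition spans_modulo (x y : V) : Prop :=
  forall z, M z -> exists c d, N (z - (c *: x + d *: y)).

(** Change of basis: [p] and [q] are independent modulo [N], as each lies in one of the subspaces
    and not in the other. Their coordinate matrix is therefore invertible, and Cramer's rule gives
    the new coordinates. *)
Lemma spans_moduloP L1 L2 x y p q :
  spans_modulo x y -> intermediate N M L1 -> intermediate N M L2 ->
  L1 p -> ~ L2 p -> L2 q -> ~ L1 q -> spans_modulo p q.
Proof.
move=> sp [H1 N1 M1] [H2 N2 M2] L1p nL2p L2q nL1q z Mz.
have [a [b Np]] := sp p (M1 _ L1p).
have [c [d Nq]] := sp q (M2 _ L2q).
have indep s t : N (s *: p + t *: q) -> s = 0 /\ t = 0.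
  move=> Nst; split; apply/eqP; apply: contrapT => /negP nz.
    apply/nL2p/(linear_setZK H2 nz).
    rewrite (_ : s *: p = (s *: p + t *: q) - t *: q); last by lmod (F : Type).
    by apply: linear_setB => //; [exact: N2|exact: linear_setZ].
  apply/nL1q/(linear_setZK H1 nz).
  rewrite (_ : t *: q = (s *: p + t *: q) - s *: p); last by lmod (F : Type).
  by apply: linear_setB => //; [exact: N1|exact: linear_setZ].
(* A zero determinant puts [d *: p - b *: q] and [c *: p - a *: q] in [N]. Independence then kills
   all four coordinates, so [p] lies in [N], hence in [L2]. *)
have det0 : a * d - b * c != 0.
  apply/eqP => det0.
  have [d0 /eqP] : d = 0 /\ - b = 0.
    apply: indep.
    rewrite (_ : _ + _ = d *: (p - (a *: x + b *: y)) - b *: (q - (c *: x + d *: y))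
                         + (a * d - b * c) *: x); last by lmod (F : Type).
    rewrite det0 scale0r addr0.
    by apply: linear_setB => //; exact: linear_setZ.
  rewrite oppr_eq0 => /eqP b0.
  have [c0 /eqP] : c = 0 /\ - a = 0.
    apply: indep.
    rewrite (_ : _ + _ = c *: (p - (a *: x + b *: y)) - a *: (q - (c *: x + d *: y))
                         - (a * d - b * c) *: y); last by lmod (F : Type).
    rewrite det0 scale0r subr0.
    by apply: linear_setB => //; exact: linear_setZ.
  rewrite oppr_eq0 => /eqP a0.
  by apply/nL2p/N2; move: Np; rewrite a0 b0 !scale0r addr0 subr0.
have [s [t Nz]] := sp z Mz.
pose D := a * d - b * c.
pose u := (s * d - t * c) / D; pose v := (a * t - b * s) / D.
exists u, v.
rewrite (_ : _ - _ = (z - (s *: x + t *: y)) - u *: (p - (a *: x + b *: y))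
                         - v *: (q - (c *: x + d *: y))).
  by do 2![apply: linear_setB => //; last exact: linear_setZ].
have -> : s = u * a + v * c by rewrite /u /v /D; field.
have -> : t = u * b + v * d by rewrite /u /v /D; field.
by lmod (F : Type).
Qed.

(* In the quotient [M / N] three distinct lines are eigenspaces, so [S] acts there as a scalar. *)
Lemma intermediate_invariant x y (S : V -> V) L1 L2 L3 :
  (forall (c : F) p q, S (c *: p + q) = c *: S p + S q) ->
  (forall p, N p -> N (S p)) -> spans_modulo x y ->
  intermediate N M L1 -> intermediate N M L2 -> intermediate N M L3 ->
  (forall p, L1 p -> L1 (S p)) -> (forall p, L2 p -> L2 (S p)) ->
  (forall p, L3 p -> L3 (S p)) ->
  ~ L1 `<=` L2 -> ~ L2 `<=` L1 -> ~ L3 `<=` L1 -> ~ L3 `<=` L2 -> ~ L1 `<=` L3 ->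
  forall L, intermediate N M L -> forall p, L p -> L (S p).
Proof.
move=> Sl SN sp0 I1 I2 I3 S1 S2 S3 n12 n21 n31 n32 n13.
have [p [L1p nL2p]] := nonsubset n12; have [q [L2q nL1q]] := nonsubset n21.
have sp := spans_moduloP sp0 I1 I2 L1p nL2p L2q nL1q.
have [[[H1 N1 M1] [H2 N2 M2]] [H3 N3 M3]] := (I1, I2, I3).
have S0 : S 0 = 0.
  by have := Sl (-1) 0 0; rewrite scaleN1r oppr0 addr0 => ->; rewrite scaleN1r addNr.
have SD u v : S (u + v) = S u + S v by rewrite -[u in LHS]scale1r Sl scale1r.
have SZ c u : S (c *: u) = c *: S u by rewrite -[_ *: u in LHS]addr0 Sl S0 addr0.
have SB u v : S (u - v) = S u - S v by rewrite SD -scaleN1r SZ scaleN1r.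
(* [S p] stays in [L1], which does not contain [q], so its [q]-coordinate vanishes: [p] is an
   eigenvector modulo [N]. The same holds for [q] with the roles exchanged. *)
have [a Na] : exists a, N (S p - a *: p).
  have [a [b Nab]] := sp (S p) (M1 _ (S1 _ L1p)); exists a.
  have L1b : L1 (b *: q).
    rewrite (_ : _ *: _ = S p - a *: p - (S p - (a *: p + b *: q))); last by lmod (F : Type).
    apply: linear_setB => //; last exact: N1.
    by apply: linear_setB => //; [exact: S1|exact: linear_setZ].
  have [b0|nb0] := eqVneq b 0; first by move: Nab; rewrite b0 scale0r addr0.
  by case: nL1q; exact: linear_setZK L1b.
have [b Nb] : exists b, N (S q - b *: q).
  have [c [b Ncb]] := sp (S q) (M2 _ (S2 _ L2q)); exists b.
  have L2c : L2 (c *: p).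
    rewrite (_ : _ *: _ = S q - b *: q - (S q - (c *: p + b *: q))); last by lmod (F : Type).
    apply: linear_setB => //; last exact: N2.
    by apply: linear_setB => //; [exact: S2|exact: linear_setZ].
  have [c0|nc0] := eqVneq c 0; first by move: Ncb; rewrite c0 scale0r add0r.
  by case: nL2p; exact: linear_setZK L2c.
(* An element of [L3] outside [L2] has a nonzero [p]-coordinate; with [q] in [L3] this would bring
   [p], and then all of [L1], into [L3]. *)
have nL3q : ~ L3 q.
  move=> L3q; have [r [L3r nL2r]] := nonsubset n32.
  have [c [d Nr]] := sp r (M3 _ L3r).
  have c0 : c != 0.
    apply/eqP => c0; apply: nL2r.
    rewrite (_ : r = (r - (c *: p + d *: q)) + d *: q); last first.
      by rewrite c0; lmod (F : Type).
    by apply: linear_setD => //; [exact: N2|exact: linear_setZ].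
  have L3p : L3 p.
    apply: (linear_setZK H3 c0).
    rewrite (_ : _ *: _ = r - d *: q - (r - (c *: p + d *: q))); last by lmod (F : Type).
    apply: linear_setB => //; last exact: N3.
    by apply: linear_setB => //; exact: linear_setZ.
  apply: n13 => z L1z; have [s [t Nz]] := sp z (M1 _ L1z).
  rewrite (_ : z = (z - (s *: p + t *: q)) + (s *: p + t *: q)); last by lmod (F : Type).
  by apply: linear_setD => //; [exact: N3|apply: linear_setD => //; exact: linear_setZ].
(* The deviation of [S] from the scalar [a] is seen only on the [q]-coordinate. *)
have Sscal z c d : N (z - (c *: p + d *: q)) ->
    N (S z - a *: z - (d * (b - a)) *: q).
  move=> Nz.
  rewrite (_ : _ - _ = S (z - (c *: p + d *: q)) - a *: (z - (c *: p + d *: q))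
    + (c *: (S p - a *: p) + d *: (S q - b *: q))).
    apply: linear_setD => //; last by apply: linear_setD => //; exact: linear_setZ.
    by apply: linear_setB => //; [exact: SN|exact: linear_setZ].
  by rewrite SB SD !SZ; lmod (F : Type).
(* Take [r] in [L3] outside [L1], so that its [q]-coordinate [d] is nonzero. As [S r - a *: r] is in
   [L3], so is [(d * (b - a)) *: q]; but [q] is not. *)
have eqab : b - a = 0.
  have [r [L3r nL1r]] := nonsubset n31.
  have [c [d Nr]] := sp r (M3 _ L3r).
  have d0 : d != 0.
    apply/eqP => d0; apply: nL1r.
    rewrite (_ : r = (r - (c *: p + d *: q)) + c *: p); last first.
      by rewrite d0; lmod (F : Type).
    by apply: linear_setD => //; [exact: N1|exact: linear_setZ].
  apply/eqP; apply: contrapT => /negP nz.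
  apply: nL3q; apply: (@linear_setZK _ (d * (b - a))) => //; first by rewrite mulf_neq0.
  have := N3 _ (Sscal _ _ _ Nr).
  set w := _ *: q => L3w.
  rewrite (_ : w = (S r - a *: r) - (S r - a *: r - w)); last by lmod (F : Type).
  apply: linear_setB => //.
  by apply: linear_setB => //; [exact: S3|exact: linear_setZ].
move=> L [HL NL LM] z Lz; have [c [d Nz]] := sp z (LM _ Lz).
have := NL _ (Sscal _ _ _ Nz).
rewrite eqab mulr0 scale0r subr0 => LS.
rewrite (_ : S z = (S z - a *: z) + a *: z); last by lmod (F : Type).
by apply: linear_setD => //; exact: linear_setZ.
Qed.

End IntermediateSubspaces.

(** * Inner product, Cauchy-Schwarz and the norm *)

Section InnerProduct.
Variables (R : realType) (H : lmodType R[i]) (ip : H -> H -> R[i]).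
Hypothesis hip : inner_product ip.
Implicit Types (x y z : H) (S : set H).

Lemma ipZDl (c : R[i]) x y z : ip (c *: x + y) z = c * ip x z + ip y z.
Proof. by case: hip. Qed.

Lemma ipC x y : ip x y = conjc (ip y x).
Proof. by case: hip. Qed.

Lemma ipDl x y z : ip (x + y) z = ip x z + ip y z.
Proof. by rewrite -[x in LHS]scale1r ipZDl mul1r. Qed.

Lemma ip0l x : ip 0 x = 0.
Proof. by apply: (addrI (ip 0 x)); rewrite -ipDl !addr0. Qed.

Lemma ipZl (c : R[i]) x y : ip (c *: x) y = c * ip x y.
Proof. by rewrite -[_ *: _]addr0 ipZDl ip0l addr0. Qed.

Lemma ipNl x y : ip (- x) y = - ip x y.
Proof. by rewrite -scaleN1r ipZl mulN1r. Qed.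

Lemma ip0r x : ip x 0 = 0.
Proof. by rewrite ipC ip0l rmorph0. Qed.

Lemma ipDr x y z : ip x (y + z) = ip x y + ip x z.
Proof. by rewrite ipC ipDl rmorphD /= -!ipC. Qed.

Lemma ipZr (c : R[i]) x y : ip x (c *: y) = conjc c * ip x y.
Proof. by rewrite ipC ipZl rmorphM /= -ipC. Qed.

Lemma ipNr x y : ip x (- y) = - ip x y.
Proof. by rewrite ipC ipNl rmorphN /= -ipC. Qed.

Definition ipE := (ipDl, ipDr, ipNl, ipNr, ipZl, ipZr, ip0l, ip0r).

(** The underlying real inner product, on which estimates become ordered-field arithmetic. *)
Definition rip x y : R := complex.Re (ip x y).

Lemma ReD (a b : R[i]) : complex.Re (a + b) = complex.Re a + complex.Re b.
Proof. by case: a b => [? ?] []. Qed.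

Lemma ReN (a : R[i]) : complex.Re (- a) = - complex.Re a.
Proof. by case: a. Qed.

Lemma ReZ (r : R) (a : R[i]) : complex.Re (r%:C%C * a) = r * complex.Re a.
Proof. by case: a => a b /=; rewrite mul0r subr0. Qed.

Lemma ImD (a b : R[i]) : complex.Im (a + b) = complex.Im a + complex.Im b.
Proof. by case: a b => [? ?] []. Qed.

Lemma ripC x y : rip x y = rip y x.
Proof. by rewrite /rip ipC; case: (ip y x). Qed.

Lemma ripDl x y z : rip (x + y) z = rip x z + rip y z.
Proof. by rewrite /rip ipDl ReD. Qed.

Lemma ripDr x y z : rip x (y + z) = rip x y + rip x z.
Proof. by rewrite /rip ipDr ReD. Qed.

Lemma ripNl x y : rip (- x) y = - rip x y.
Proof. by rewrite /rip ipNl ReN. Qed.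

Lemma ripNr x y : rip x (- y) = - rip x y.
Proof. by rewrite /rip ipNr ReN. Qed.

Lemma ripZl (r : R) x y : rip (r%:C%C *: x) y = r * rip x y.
Proof. by rewrite /rip ipZl ReZ. Qed.

Lemma ripZr (r : R) x y : rip x (r%:C%C *: y) = r * rip x y.
Proof. by rewrite ripC ripZl ripC. Qed.

Definition ripE := (ripDl, ripDr, ripNl, ripNr, ripZl, ripZr).

Lemma rip_ge0 x : 0 <= rip x x.
Proof. by case: hip => _ _ + _; apply. Qed.

Lemma Im_ip x : complex.Im (ip x x) = 0.
Proof. by have := ipC x x; case: (ip x x) => a b [] /=; lra. Qed.

Lemma ip_rip x : ip x x = (rip x x)%:C%C.
Proof. by rewrite /rip; have := Im_ip x; case: (ip x x) => a b /= ->. Qed.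

Lemma rip_eq0 x : rip x x = 0 -> x = 0.
Proof. by move=> x0; case: hip => _ _ _; apply; rewrite ip_rip x0. Qed.

Lemma rip_gt0 x : x <> 0 -> 0 < rip x x.
Proof.
move=> x0; rewrite lt_neqAle rip_ge0 andbT eq_sym; apply/eqP.
by move/rip_eq0/x0.
Qed.

Lemma sqr_hnorm x : hnorm ip x ^+ 2 = rip x x.
Proof. by rewrite sqr_sqrtr ?rip_ge0. Qed.

Lemma hnorm_ge0 x : 0 <= hnorm ip x.
Proof. exact: sqrtr_ge0. Qed.

Lemma hnormN x : hnorm ip (- x) = hnorm ip x.
Proof. by rewrite /hnorm ipNl ipNr opprK. Qed.

(** Expand the squared norm of [(y,y) x - (x,y) y] and cancel the positive factor [(y,y)]; no
    division occurs. *)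
Lemma rip_sqr_le x y : rip x y ^+ 2 <= rip x x * rip y y.
Proof.
have [y0|/eqP /rip_gt0 y0] := eqVneq y 0.
  by rewrite /rip y0 !ip0r mulr0 expr0n.
have := rip_ge0 ((rip y y)%:C%C *: x - (rip x y)%:C%C *: y).
rewrite !ripE [rip y x]ripC.
set a := rip x x; set b := rip x y; set c := rip y y => h.
rewrite -subr_ge0 -(pmulr_rge0 _ y0); move: h; congr (0 <= _); rewrite -/c; ring.
Qed.

Lemma rip_le x y : rip x y <= hnorm ip x * hnorm ip y.
Proof.
have [le0|/ltW ge0] := lerP (rip x y) 0.
  by apply: le_trans le0 _; rewrite mulr_ge0 ?hnorm_ge0.
rewrite -(ler_pXn2r (n := 2)) ?nnegrE ?mulr_ge0 ?hnorm_ge0 //.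
by rewrite exprMn !sqr_hnorm rip_sqr_le.
Qed.

Lemma rip_norm_le x y : `|rip x y| <= hnorm ip x * hnorm ip y.
Proof.
by rewrite ler_norml rip_le andbT lerNl -ripNl -(hnormN x) rip_le.
Qed.

Lemma hnormD x y : hnorm ip (x + y) <= hnorm ip x + hnorm ip y.
Proof.
rewrite -(ler_pXn2r (n := 2)) ?nnegrE ?addr_ge0 ?hnorm_ge0 //.
rewrite sqrrD !sqr_hnorm !ripE [rip y x]ripC.
have := rip_le x y; set a := rip x y; set b := _ * _; lra.
Qed.

Lemma hnormZ (c : R[i]) x : hnorm ip (c *: x) = Normc.normc c * hnorm ip x.
Proof.
rewrite /hnorm ipZl ipZr mulrA ip_rip -/(rip x x) /Normc.normc; case: c => a b.
rewrite -sqrtrM ?addr_ge0 ?sqr_ge0 //=; congr Num.sqrt; ring.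
Qed.

End InnerProduct.

(** * Orthogonal projection onto a complete subspace *)

Section Projection.
Variables (R : realType) (H : lmodType R[i]) (ip : H -> H -> R[i]).
Hypothesis hip : inner_product ip.

(** Replacing [t] by [-t] turns the inequality into an equality of real parts; replacing [t] by
    [i t] then handles the imaginary part. *)
Lemma ip_eq0 x (S : set H) : linear_set S -> (forall t, S t -> rip ip x t <= 0) ->
  forall t, S t -> ip x t = 0.
Proof.
move=> HS le0 t St.
have eq0 s : S s -> rip ip x s = 0.
  move=> Ss; apply/eqP; rewrite eq_le le0 //= -oppr_le0 -(ripNr hip) le0 //.
  by rewrite -scaleN1r; exact: linear_setZ.
have := eq0 _ St; have := eq0 _ (linear_setZ 'i%C HS St).
by rewrite /rip (ipZr hip); case: (ip x t) => a b /=; simpc => /= -> ->.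
Qed.

Lemma invr_natS_lt (eps : R) : 0 < eps ->
  exists N : nat, forall n, (N <= n)%N -> n.+1%:R^-1 < eps.
Proof.
move=> eps0; exists (Num.bound eps^-1) => n le.
rewrite -[ltRHS]invrK ltf_pV2 ?posrE ?invr_gt0 ?ltr0n //.
apply: lt_le_trans (archi_boundP _) _; first by rewrite invr_ge0 ltW.
by rewrite ler_nat; exact: leqW.
Qed.

(** A minimising sequence for the distance from [y] to [S] is Cauchy, and the residual at its limit
    is orthogonal to [S]. *)
Lemma orthogonal_projection (S : set H) (y : H) : linear_set S ->
  (forall u, (forall n, S (u n)) -> cauchy ip u -> exists x, S x /\ converges ip u x) ->
  exists s, S s /\ forall t, S t -> ip (y - s) t = 0.
Proof.
move=> HS complS.
pose E := (fun s : H => rip ip (y - s) (y - s)) @` S.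
have hE : has_inf E.
  split; first by exists (rip ip (y - 0) (y - 0)), 0 => //; case: HS.
  by exists 0 => _ [s _ <-]; exact: rip_ge0.
pose d := inf E.
have low s : S s -> d <= rip ip (y - s) (y - s).
  by move=> Ss; apply: ge_inf; [case: hE|exists s].
have /choice[u uP] (n : nat) :
    exists s, S s /\ rip ip (y - s) (y - s) < d + n.+1%:R^-1.
  have n0 : 0 < n.+1%:R^-1 :> R by rewrite invr_gt0 ltr0n.
  by have [_ [s Ss <-] lt] := inf_adherent n0 hE; exists s.
have uS n : S (u n) by case: (uP n).
(* Parallelogram law: the midpoint of [u n] and [u m] lies in [S], so it is at squared distance at
   least [d] from [y]. *)
have uclose n m : rip ip (u n - u m) (u n - u m) <= 2 * (n.+1%:R^-1 + m.+1%:R^-1).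
  pose a := y - u n; pose b := y - u m.
  have := low (((2^-1)%:C)%C *: (u n + u m)).
  rewrite (_ : y - _ = ((2^-1)%:C)%C *: (a + b)); last first.
    rewrite /a /b; have {1}-> : y = (((2^-1)%:C)%C + ((2^-1)%:C)%C) *: y.
      by rewrite -rmorphD /= (_ : 2^-1 + 2^-1 = 1) ?scale1r //; lra.
    by lmod R[i].
  rewrite (_ : u n - u m = b - a); last by rewrite /a /b; lmod R[i].
  have := (uP n).2; have := (uP m).2; rewrite -/a -/b.
  have S' : S (((2^-1)%:C)%C *: (u n + u m)).
    by apply: linear_setZ => //; exact: linear_setD.
  move=> + + /(_ S'); clearbody a b; rewrite !(ripE hip) (ripC hip b a).
  by move: (n.+1%:R^-1) (m.+1%:R^-1) => en em; lra.
have uC : cauchy ip u.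
  move=> eps eps0; have e4 : 0 < eps ^+ 2 / 4 by rewrite divr_gt0 ?exprn_gt0 ?ltr0n.
  have [N NP] := invr_natS_lt e4; exists N => n m /NP ln /NP lm.
  rewrite -(ltr_pXn2r (n := 2)) ?nnegrE ?hnorm_ge0 ?ltW // sqr_hnorm //.
  by move: (uclose n m) ln lm; move: (n.+1%:R^-1) (m.+1%:R^-1) => en em; lra.
have [x [Sx ux]] := complS u uS uC; exists x; split=> //.
(* If the residual had a positive product [b] with [t], then for large [n] moving [u n] by [r t]
   would lower the squared distance by more than its excess over the infimum [d]. *)
apply: ip_eq0 => // t St; rewrite leNgt; apply/negP => b0.
pose T := rip ip t t; have T0 : 0 <= T by exact: rip_ge0.
pose b := rip ip (y - x) t; rewrite -/b in b0.
(* The best step would be [b / T]; adding 1 keeps the denominator visibly positive and still gives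
   [r * T <= b]. *)
pose r := b / (T + 1); have r0 : 0 < r by rewrite divr_gt0 // ltr_wpDl.
have rb : r * T <= b by rewrite /r mulrAC ler_pdivrMr ?ltr_wpDl // ler_pM2l //; lra.
have rb4 : 0 < r * b / 4 by rewrite divr_gt0 // mulr_gt0.
have t1 : 0 < hnorm ip t + 1 by rewrite ltr_wpDl ?hnorm_ge0.
have e0 : 0 < b / (4 * (hnorm ip t + 1)) by rewrite divr_gt0 // mulr_gt0.
have [N1 N1P] := invr_natS_lt rb4; have [N2 N2P] := ux _ e0.
pose n := maxn N1 N2.
have := N1P n (leq_maxl _ _); have := N2P n (leq_maxr _ _).
set w := u n - x => wn en.
have : rip ip w t < b / 4.
  apply: le_lt_trans (rip_le hip _ _) _.
  rewrite (_ : b / 4 = b / (4 * (hnorm ip t + 1)) * (hnorm ip t + 1)); last first.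
    by field; rewrite gt_eqF.
  apply: (@le_lt_trans _ _ (hnorm ip w * (hnorm ip t + 1))).
    by rewrite ler_wpM2l ?hnorm_ge0 // lerDl.
  by rewrite ltr_pM2r.
have := low (u n + (r%:C)%C *: t).
have -> : y - (u n + (r%:C)%C *: t) = (y - x) - w - (r%:C)%C *: t.
  by rewrite /w; lmod R[i].
have Sn : S (u n + (r%:C)%C *: t) by apply: linear_setD => //; exact: linear_setZ.
move=> /(_ Sn); have := (uP n).2.
have -> : y - u n = (y - x) - w by rewrite /w; lmod R[i].
have expand z1 : rip ip (z1 - (r%:C)%C *: t) (z1 - (r%:C)%C *: t) =
    rip ip z1 z1 - 2 * r * rip ip z1 t + r ^+ 2 * T.
  by rewrite !(ripE hip) !(ripC hip t) -/T; ring.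
rewrite expand (_ : rip ip (y - x - w) t = b - rip ip w t); last first.
  by rewrite (ripDl hip) (ripNl hip).
move: en; move: (rip ip w t) (rip ip (y - x - w) _) (n.+1%:R^-1) => W Q en.
clearbody r b T d => en_lt Qlt dle Wlt.
have h1 : 0 < r * (b / 4 - W) by rewrite mulr_gt0 // subr_gt0.
have h2 : 0 <= r * (b - r * T) by rewrite mulr_ge0 ?subr_ge0 // ltW.
by move: en_lt Qlt dle h1 h2; rewrite !mulrBr expr2 !mulrA; lra.
Qed.

End Projection.

(** * The boundary form, ranges, and von Neumann's formula *)

Section Operators.
Variables (R : realType) (H : lmodType R[i]) (ip : H -> H -> R[i]).
Hypothesis hip : inner_product ip.
Hypothesis complH : forall u, cauchy ip u -> exists x, converges ip u x.
Implicit Types (A B : operator H) (x y f h : H) (p q : H * H).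

Lemma convergesDZ (u v : nat -> H) (c : R[i]) x y :
  converges ip u x -> converges ip v y ->
  converges ip (fun n => v n + c *: u n) (y + c *: x).
Proof.
move=> ux vy eps eps0.
have c1 : 0 < Normc.normc c + 1.
  by rewrite ltr_wpDl // /Normc.normc; case: c => a b; rewrite sqrtr_ge0.
have e0 : 0 < eps / 2 / (Normc.normc c + 1) by rewrite !divr_gt0.
have e2 : 0 < eps / 2 by rewrite divr_gt0.
have [N1 N1P] := ux _ e0; have [N2 N2P] := vy _ e2.
exists (maxn N1 N2) => n; rewrite geq_max => /andP[/N1P n1 /N2P n2].
rewrite (_ : _ - _ = (v n - y) + c *: (u n - x)); last by lmod R[i].
apply: le_lt_trans (hnormD hip _ _) _.
rewrite (splitr eps) ltr_leD // (hnormZ hip).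
apply: (@le_trans _ _ ((Normc.normc c + 1) * hnorm ip (u n - x))).
  by rewrite ler_wpM2r ?hnorm_ge0 // lerDl.
by rewrite mulrC -ler_pdivlMr // ltW.
Qed.

(** The boundary form on pairs of graph elements. It is skew-Hermitian, and the adjoint is the
    orthogonal complement of a graph with respect to it. *)
Definition bform p q : R[i] := ip p.2 q.1 - ip p.1 q.2.

Lemma adjointP A q : adjoint ip A q <-> forall p, A p -> bform p q = 0.
Proof.
split=> [Aq p /Aq|Aq p /Aq /eqP]; first by rewrite /bform => ->; rewrite subrr.
by rewrite /bform subr_eq0 => /eqP.
Qed.

Lemma bformDl p q r : bform (p + q) r = bform p r + bform q r.
Proof. by rewrite /bform /= !(ipE hip); ring. Qed.

Lemma bformZl (c : R[i]) p q : bform (c *: p) q = c * bform p q.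
Proof. by rewrite /bform /= !(ipE hip); ring. Qed.

Lemma bformC p q : bform p q = - conjc (bform q p).
Proof. by rewrite /bform rmorphB /= -!(ipC hip) opprB. Qed.

Lemma bformDr p q r : bform r (p + q) = bform r p + bform r q.
Proof. by rewrite bformC bformDl rmorphD opprD /= -!bformC. Qed.

Lemma bformZr (c : R[i]) p q : bform q (c *: p) = conjc c * bform q p.
Proof. by rewrite bformC bformZl rmorphM -mulrN /= -!bformC. Qed.

Lemma bform0_sym p q : bform p q = 0 -> bform q p = 0.
Proof. by move=> pq0; rewrite bformC pq0 rmorph0 oppr0. Qed.

Lemma linear_adjoint A : linear_set (adjoint ip A).
Proof.
split; first by apply/adjointP => p _; rewrite /bform /= !(ip0r hip) subrr.
move=> c p q /adjointP Ap /adjointP Aq; apply/adjointP => r Ar.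
by rewrite bformDr bformZr Ap // Aq // mulr0 addr0.
Qed.

Lemma linear_operator A : is_operator A -> linear_set A.
Proof. by case. Qed.

Lemma adjoint_anti A B : A `<=` B -> adjoint ip B `<=` adjoint ip A.
Proof. by move=> AB p Bp q /AB; exact: Bp. Qed.

Lemma bform_diag p : bform p p = 0 <-> complex.Im (ip p.2 p.1) = 0.
Proof.
rewrite /bform (ipC hip p.1); case: (ip _ _) => a b; simpc => /=.
by split=> [[]|->]; [lra|rewrite addr0].
Qed.

Lemma symmetric_Im A f h : symmetric_op ip A -> A (f, h) -> complex.Im (ip h f) = 0.
Proof. by move=> [_ [_ AA]] Afh; apply/(bform_diag (f, h)); move/adjointP: (AA _ Afh); exact. Qed.

(** The lower bound makes the range of [A - c] complete, so [y] can be projected onto it; a vector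
    orthogonal to this range is in the kernel of the adjoint minus [conjc c]. *)
Lemma range_deficiency_decomposition A (c : R[i]) (delta : R) :
  closed_op ip A -> is_operator A -> 0 < delta ->
  (forall f h, A (f, h) -> delta * hnorm ip f <= hnorm ip (h - c *: f)) ->
  forall y, exists f h w,
    [/\ A (f, h), adjoint ip A (w, conjc c *: w) & y = (h - c *: f) + w].
Proof.
move=> Acl Aop delta0 low y; have HA := linear_operator Aop.
pose S := [set z : H | exists f h, A (f, h) /\ z = h - c *: f].
have HS : linear_set S.
  split; first by exists 0, 0; split; [case: Aop|rewrite scaler0 subr0].
  move=> d z1 z2 [f1 [h1 [A1 ->]]] [f2 [h2 [A2 ->]]].
  exists (d *: f1 + f2), (d *: h1 + h2); split; last by lmod R[i].
  by case: Aop => _ /(_ d _ _ A1 A2).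
have complS u : (forall n, S (u n)) -> cauchy ip u -> exists x, S x /\ converges ip u x.
  move=> uS uC.
  have /choice[a aP] (n : nat) : exists p, A p /\ u n = p.2 - c *: p.1.
    by have [f [h fh]] := uS n; exists (f, h).
  have [z uz] := complH uC.
  (* The lower bound carries the Cauchy property from the images back to the preimages; closedness
     of [A] then identifies the limit. *)
  have /complH[f af] : cauchy ip (fun n => (a n).1).
    move=> eps eps0; have [N NP] := uC _ (mulr_gt0 delta0 eps0).
    exists N => n m ln lm; rewrite -(ltr_pM2l delta0).
    apply: le_lt_trans (NP n m ln lm).
    have -> : u n - u m = ((a n).2 - (a m).2) - c *: ((a n).1 - (a m).1).
      by rewrite (aP n).2 (aP m).2; lmod R[i].
    apply: low; have := linear_setB HA (aP n).1 (aP m).1.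
    by [].
  have ah : converges ip (fun n => (a n).2) (z + c *: f).
    rewrite (_ : (fun _ => _) = (fun n => u n + c *: (a n).1)).
      exact: convergesDZ.
    by apply/funext => n; rewrite (aP n).2 subrK.
  exists z; split=> //; exists f, (z + c *: f); split; last by rewrite addrK.
  apply: Acl af ah => n; have := (aP n).1; by case: (a n).
have [s [[f [h [Afh ->]]] orth]] := orthogonal_projection hip y HS complS.
exists f, h, (y - (h - c *: f)); split=> //; last by rewrite addrC subrK.
move=> q Aq /=; set w := y - _.
have : ip w (q.2 - c *: q.1) = 0.
  by apply: orth; exists q.1, q.2; split=> //; case: q Aq.
rewrite (ipC hip) => /eqP; rewrite conjc_eq0 (ipDl hip) (ipNl hip) (ipZl hip).
by rewrite subr_eq0 (ipZr hip) conjcK => /eqP.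
Qed.

(** Symmetry makes the squared norm of [(A + i) u] the sum of those of [A u] and [u], so the range
    decomposition applies with [c = -i]. Applied to [h + i f], it yields [u] in the domain of [A]
    and [w] in one deficiency space; what remains of [f] lies in the other. *)
Lemma von_neumann_spans A (vp vm : H) :
  closed_op ip A -> symmetric_op ip A ->
  (forall w, adjoint ip A (w, 'i%C *: w) <-> exists c : R[i], w = c *: vp) ->
  (forall w, adjoint ip A (w, - ('i%C *: w)) <-> exists c : R[i], w = c *: vm) ->
  spans_modulo A (adjoint ip A) (vp, 'i%C *: vp) (vm, - ('i%C *: vm)).
Proof.
move=> Acl Asym Hp Hm [f h] Afh; have [Aop [_ AA]] := Asym.
have low u v : A (u, v) -> 1 * hnorm ip u <= hnorm ip (v - (- 'i%C) *: u).
  move=> Auv; rewrite mul1r -(ler_pXn2r (n := 2)) ?nnegrE ?hnorm_ge0 //.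
  rewrite !(sqr_hnorm hip) scaleNr opprK !(ripE hip) (ripC hip ('i%C *: u) v).
  have -> : rip ip v ('i%C *: u) = 0.
    rewrite /rip (ipZr hip); have := symmetric_Im Asym Auv.
    by case: (ip v u) => a b /= ->; simpc.
  have -> : rip ip ('i%C *: u) ('i%C *: u) = rip ip u u.
    by rewrite /rip (ipZr hip) (ipZl hip); case: (ip u u) => a b; simpc.
  by have := rip_ge0 hip v; lra.
have [u [v [w [Auv Aw E]]]] :=
  range_deficiency_decomposition Acl Aop ltr01 low (h + 'i%C *: f).
(* [k] is the inverse of [2i]: the adjoint plus [i] multiplies [w] by [2i], so subtracting [k *: w]
   from [f] removes [w] from [h + i f]. *)
pose k : R[i] := - 'i%C / 2.
have ki : 1 - 2 * (k * 'i%C) = 0 :> R[i].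
  by rewrite /k (_ : _ - _ = 1 + 'i%C ^+ 2); [rewrite sqr_i subrr|field].
have conjNi : conjc (- 'i%C) = 'i%C :> R[i] by rewrite /= oppr0 opprK.
rewrite conjNi in Aw.
have [cw Ew] := (Hp w).1 Aw.
pose z := f - u - k *: w.
have Ez : h - v - k *: ('i%C *: w) = - ('i%C *: z).
  rewrite (_ : h = (h + 'i%C *: f) - 'i%C *: f); last by lmod R[i].
  rewrite E /z; transitivity (- ('i%C *: (f - u - k *: w)) + (1 - 2 * (k * 'i%C)) *: w).
    by lmod R[i].
  by rewrite ki scale0r addr0.
have Az : adjoint ip A (z, - ('i%C *: z)).
  rewrite -Ez; have HA := linear_adjoint A.
  exact: (linear_setB HA (linear_setB HA Afh (AA _ Auv)) (linear_setZ k HA Aw)).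
have [cz zE] := (Hm z).1 Az.
exists (k * cw), cz.
have Eu : u = f - (k * cw) *: vp - cz *: vm.
  by rewrite -zE /z -scalerA -Ew; lmod R[i].
have Ev : v = h - (k * cw) *: ('i%C *: vp) - cz *: (- ('i%C *: vm)).
  transitivity (h - k *: ('i%C *: w) + 'i%C *: z).
    by rewrite -[_ *: z]opprK -Ez; lmod R[i].
  by rewrite zE Ew; lmod R[i].
rewrite (_ : _ - _ = (u, v)) //.
by rewrite Eu Ev; congr (_, _) => /=; lmod R[i].
Qed.

End Operators.

(** * Adjoints of extensions and the signature of the boundary form *)

Section DissipativeExtensions.
Variables (R : realType) (H : lmodType R[i]) (ip : H -> H -> R[i]).
Hypothesis hip : inner_product ip.
Implicit Types (A B : operator H) (p q : H * H).

Lemma subset_self_adjoint A B : self_adjoint ip A -> self_adjoint ip B -> A `<=` B -> A = B.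
Proof.
move=> sA sB AB; apply/seteqP; split=> //.
by rewrite sB [X in _ `<=` X]sA; exact: adjoint_anti.
Qed.

(** [N] lies in the adjoint of [A] because [A] lies in that of [N], with the arguments of the
    boundary form exchanged. *)
Lemma intermediate_adjoint N A :
  intermediate N (adjoint ip N) A -> intermediate N (adjoint ip N) (adjoint ip A).
Proof.
move=> [_ NA AN]; split; [exact: linear_adjoint| |exact: adjoint_anti].
move=> q Nq; apply/(adjointP ip) => p Ap; apply: (bform0_sym hip).
by move/adjointP: (AN _ Ap); exact.
Qed.

Lemma Im_bform p : complex.Im (bform ip p p) = 2 * complex.Im (ip p.2 p.1).
Proof. by rewrite /bform (ipC hip p.1); case: (ip _ _) => a b; simpc => /=; ring. Qed.

Lemma Im_sqr_mul_ge0 (c z : R[i]) :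
  0 <= complex.Im z -> 0 <= complex.Im (c * (conjc c * z)).
Proof.
case: c z => a b [x y] /= y0.
rewrite (_ : _ + _ = (a ^+ 2 + b ^+ 2) * y); last by ring.
by rewrite mulr_ge0 // addr_ge0 ?sqr_ge0.
Qed.

Variables (N A1 A2 : operator H) (x y : H * H).
Hypotheses (HN : linear_set N) (sp : spans_modulo N (adjoint ip N) x y).
Hypotheses (I1 : intermediate N (adjoint ip N) A1) (I2 : intermediate N (adjoint ip N) A2).
Hypotheses (D1 : dissipative ip A1) (D2 : dissipative ip A2).
Hypotheses (n12 : ~ A1 `<=` A2) (n21 : ~ A2 `<=` A1).
Hypothesis indefinite : exists p, adjoint ip N p /\ complex.Im (ip p.2 p.1) < 0.

(* Modulo [N], the extension [A1] is a line on which the boundary form is strictly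
   positive, its adjoint is the orthogonal line, and [A2] cannot contain the latter
   since the boundary form has signature (1,1). *)
Lemma adjoint_third_line : ~ self_adjoint ip A1 ->
  [/\ ~ adjoint ip A1 `<=` A1, ~ adjoint ip A1 `<=` A2 & ~ A1 `<=` adjoint ip A1].
Proof.
move=> nsa.
have [[[H1 N1 M1] [H2 N2 M2]] [H1' N1' M1']] := (I1, I2, intermediate_adjoint I1).
have [p [A1p nA2p]] := nonsubset n12; have [q [A2q nA1q]] := nonsubset n21.
have spq := spans_moduloP HN sp I1 I2 A1p nA2p A2q nA1q.
have N0 u v : N u -> adjoint ip N v -> bform ip u v = 0.
  by move=> Nu /adjointP; exact.
have A1span r : A1 r -> exists c, N (r - c *: p).
  move=> A1r; have [c [d Nr]] := spq _ (M1 _ A1r); exists c.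
  have [d0|d0] := eqVneq d 0; first by move: Nr; rewrite d0 scale0r addr0.
  case: nA1q; apply: (linear_setZK H1 d0).
  rewrite (_ : _ *: _ = r - c *: p - (r - (c *: p + d *: q))); last by lmod R[i].
  apply: linear_setB => //; last exact: N1.
  by apply: linear_setB => //; exact: linear_setZ.
have inA1' r : adjoint ip N r -> bform ip p r = 0 -> adjoint ip A1 r.
  move=> Nr pr; apply/adjointP => t /A1span[c Nt].
  rewrite (_ : t = (t - c *: p) + c *: p); last by rewrite subrK.
  by rewrite (bformDl hip) (bformZl hip) pr mulr0 addr0 N0.
have Im_ge0 A r : dissipative ip A -> A r -> 0 <= complex.Im (bform ip r r).
  by case: r => f h DA Ar; rewrite Im_bform mulr_ge0 //; exact: DA Ar.
(* Were [q] orthogonal to [p], the boundary form would be diagonal in [p], [q] with both entries of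
   nonnegative imaginary part, against [indefinite]. *)
have nA1'q : ~ adjoint ip A1 q.
  move=> /adjointP/(_ _ A1p) pq; have qp := bform0_sym hip pq.
  have [z [Nz]] := indefinite; apply/negP; rewrite -leNgt.
  have [c [d Nn]] := spq _ Nz; set n := _ - _ in Nn.
  have An : adjoint ip N n by apply: M1; exact: N1.
  rewrite -(@pmulr_rge0 _ 2) // -Im_bform.
  have -> : z = n + (c *: p + d *: q) by rewrite /n subrK.
  have Acd : adjoint ip N (c *: p + d *: q).
    have HA := linear_adjoint hip N.
    by apply: (linear_setD HA); apply: (linear_setZ _ HA); [exact: M1|exact: M2].
  rewrite (bformDl hip) !(bformDr hip n) (N0 n n) // (N0 n) // !add0r.
  rewrite (bform0_sym hip (N0 _ _ Nn Acd)) add0r.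
  rewrite (bformDl hip) !(bformZl hip) !(bformDr hip) !(bformZr hip) pq qp.
  rewrite !mulr0 addr0 add0r ImD addr_ge0 // Im_sqr_mul_ge0 //.
    exact: Im_ge0 A1p.
  exact: Im_ge0 A2q.
(* Otherwise an element of the adjoint outside [A1] has a nonzero [q]-coordinate and brings [q] into
   the adjoint. *)
have nA1A1' : ~ A1 `<=` adjoint ip A1.
  move=> A11'; apply: nsa; apply/seteqP; split=> // r A1'r.
  apply: contrapT => nA1r.
  have [c [d Nr]] := spq _ (M1' _ A1'r).
  have d0 : d != 0.
    apply/eqP => d0; apply: nA1r.
    rewrite (_ : r = (r - (c *: p + d *: q)) + c *: p); last first.
      by rewrite d0; lmod R[i].
    by apply: linear_setD => //; [exact: N1|exact: linear_setZ].
  apply: nA1'q; apply: (linear_setZK H1' d0).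
  rewrite (_ : _ *: _ = r - c *: p - (r - (c *: p + d *: q))); last by lmod R[i].
  apply: (linear_setB H1'); last exact: N1'.
  by apply: (linear_setB H1') => //; apply: (linear_setZ _ H1'); exact: A11'.
have pp0 : bform ip p p != 0.
  apply/eqP => pp0; apply: nA1A1' => r /A1span[c Nr].
  rewrite (_ : r = (r - c *: p) + c *: p); last by rewrite subrK.
  apply: (linear_setD H1'); first exact: N1'.
  by apply: (linear_setZ _ H1'); apply: inA1' => //; exact: M1.
(* Gram-Schmidt coefficient making [c *: p + q] orthogonal to [p]; it is conjugated because the form
   is conjugate-linear on the right. *)
pose c := - conjc (bform ip p q / bform ip p p).
have A1'cpq : adjoint ip A1 (c *: p + q).
  apply: inA1'.
    by case: (linear_adjoint hip N) => _; apply; [exact: M1|exact: M2].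
  by rewrite (bformDr hip) (bformZr hip) /c rmorphN /= conjcK mulNr divfK // addNr.
split=> // [/(_ _ A1'cpq) A1cpq|/(_ _ A1'cpq) A2cpq].
  apply: nA1q; rewrite (_ : q = (c *: p + q) - c *: p); last by lmod R[i].
  by apply: linear_setB => //; exact: linear_setZ.
have [c0|c0] := eqVneq c 0; first by move: A1'cpq; rewrite c0 scale0r add0r.
apply: nA2p; apply: (linear_setZK H2 c0).
rewrite (_ : c *: p = (c *: p + q) - q); last by lmod R[i].
exact: linear_setB.
Qed.

End DissipativeExtensions.

(** * The action of the affine subgroup on graphs *)

Section AffineAction.
Variables (R : realType) (H : lmodType R[i]) (ip : H -> H -> R[i]).
Hypothesis hip : inner_product ip.
Variables (G : set (R * R)) (U : R * R -> H -> H).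
Hypotheses (hG : affine_subgroup G) (hU : unitary_rep ip G U).
Implicit Types (A : operator H) (p q : H * H).

(* The graph of [U_g A U_g^-1], transformed by [y |-> (y - b) / a]; invariance of [A] under
   [g] says that the graph of [A] is preserved. *)
Definition graph_act (g : R * R) p : H * H :=
  (U g p.1, (g.1^-1)%:C%C *: (U g p.2 - (g.2)%:C%C *: U g p.1)).

(** Not among the axioms of [unitary_rep]: [U (1, 0)] is idempotent and onto, hence the identity. *)
Lemma rep_id x : U (1, 0) x = x.
Proof.
case: hG => _ G1 _ _; case: hU => _ _ surj comp.
have [z <-] := surj _ G1 x; rewrite -comp //.
by rewrite /aff_comp /= mul1r mul1r addr0.
Qed.

Lemma aff_invK g : G g -> aff_comp g (aff_inv g) = (1, 0).
Proof.
case: hG => pos _ _ _ /pos a0; rewrite /aff_comp /aff_inv /=.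
by congr pair; field; rewrite gt_eqF.
Qed.

Lemma aff_invVK g : G g -> aff_comp (aff_inv g) g = (1, 0).
Proof.
case: hG => pos _ _ _ /pos a0; rewrite /aff_comp /aff_inv /=.
by congr pair; field; rewrite gt_eqF.
Qed.

Lemma aff_inv_mem g : G g -> G (aff_inv g).
Proof. by case: hG => _ _ _; apply. Qed.

Lemma repK g x : G g -> U g (U (aff_inv g) x) = x.
Proof.
move=> Gg; case: hU => _ _ _ comp.
by rewrite -comp //; [rewrite aff_invK // rep_id|exact: aff_inv_mem].
Qed.

Lemma repVK g x : G g -> U (aff_inv g) (U g x) = x.
Proof.
move=> Gg; case: hU => _ _ _ comp.
by rewrite -comp //; [rewrite aff_invVK // rep_id|exact: aff_inv_mem].
Qed.

Lemma repZD g (c : R[i]) x y : G g -> U g (c *: x + y) = c *: U g x + U g y.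
Proof. by move=> Gg; case: hU => lin _ _ _; exact: lin. Qed.

Lemma rep0 g : G g -> U g 0 = 0.
Proof.
move=> Gg; have := repZD (-1) 0 0 Gg; rewrite scaleN1r oppr0 addr0 => ->.
by rewrite scaleN1r addNr.
Qed.

Lemma repZ g (c : R[i]) x : G g -> U g (c *: x) = c *: U g x.
Proof. by move=> Gg; rewrite -[_ *: x]addr0 repZD // rep0 // addr0. Qed.

Lemma repB g x y : G g -> U g (x - y) = U g x - U g y.
Proof.
by move=> Gg; rewrite addrC -scaleN1r repZD // scaleN1r addrC.
Qed.

Lemma graph_act_linear g (c : R[i]) p q : G g ->
  graph_act g (c *: p + q) = c *: graph_act g p + graph_act g q.
Proof.
move=> Gg; rewrite /graph_act /= !repZD //; congr (_, _) => /=.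
by lmod R[i].
Qed.

Lemma affine_pos g : G g -> 0 < g.1.
Proof. by case: hG => pos _ _ _; exact: pos. Qed.

Lemma graph_actK g p : G g -> graph_act g (graph_act (aff_inv g) p) = p.
Proof.
move=> Gg; have a0 := affine_pos Gg; case: p => f h; rewrite /graph_act /=.
rewrite repZ // repB // repZ // !repK //; congr (_, _).
have E : (g.1)%:C%C != 0 :> R[i] by rewrite fmorph_eq0 gt_eqF.
rewrite rmorphN rmorphM !fmorphV /=.
set a := (g.1)%:C%C in E *; set b := (g.2)%:C%C.
transitivity (a^-1 *: (a^-1^-1 *: h) + (a^-1 * (a^-1^-1 * (b / a)) - a^-1 * b) *: f).
  by lmod R[i].
rewrite scalerA mulfV ?invr_eq0 // scale1r.
rewrite (_ : _ - _ = 0) ?scale0r ?addr0 //.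
by field.
Qed.

(** The shift by the real number [g.2] cancels between the two terms, and unitarity leaves only the
    dilation factor. *)
Lemma bform_graph_act g p q : G g ->
  bform ip (graph_act g p) (graph_act g q) = (g.1^-1)%:C%C * bform ip p q.
Proof.
move=> Gg; case: hU => _ isom _ _.
by rewrite /bform /graph_act /= !(ipE hip) !conjc_real !isom //; ring.
Qed.

Definition graph_invariant A : Prop := forall g p, G g -> A p -> A (graph_act g p).

(** The definition transports the operator by [U_g^*], the action on graphs by [U_g]; both
    directions therefore pass through [aff_inv g]. *)
Lemma G_invariantP A : G_invariant G U A <-> graph_invariant A.
Proof.
split=> [invA g [f h] Gg Afh|invA g Gg].
  have [_ /(_ _ _ Afh (U g f))] := invA _ (aff_inv_mem Gg).
  rewrite repVK // => /(_ erefl)[h' [Ah' /(congr1 (U g))]].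
  rewrite repK // => Eh'; rewrite /graph_act /=.
  suff -> : (g.1^-1)%:C%C *: (U g h - (g.2)%:C%C *: U g f) = h' by [].
  rewrite Eh' repZD // repZ //= rmorphN rmorphM /= [(_ * _)%R]mulrC.
  by lmod R[i].
have a0 := affine_pos Gg.
have inv' f h : A (f, h) -> A (U (aff_inv g) f,
    U (aff_inv g) ((g.1)%:C%C *: h + (g.2)%:C%C *: f)).
  move=> Afh; have := invA _ _ (aff_inv_mem Gg) Afh; rewrite /graph_act /=.
  suff -> : ((g.1^-1^-1)%:C)%C *: (U (aff_inv g) h - ((- (g.2 / g.1))%:C)%C *: U (aff_inv g) f) =
    U (aff_inv g) ((g.1)%:C%C *: h + (g.2)%:C%C *: f) by [].
  have Gi := aff_inv_mem Gg; rewrite repZD // repZ // invrK.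
  have E : (g.1)%:C%C != 0 :> R[i] by rewrite fmorph_eq0 gt_eqF.
  rewrite rmorphN rmorphM fmorphV /= scaleNr opprK scalerDr scalerA.
  by rewrite mulrC divfK.
split.
  apply/seteqP; split=> [_ [f [h Afh] <-]|f [h Afh]].
    by exists (graph_act g (f, h)).2; exact: (invA g (f, h)).
  exists (U (aff_inv g) f); last by rewrite repK.
  by eexists; exact: inv' Afh.
move=> f h Afh f' Ef; exists (U (aff_inv g) ((g.1)%:C%C *: h + (g.2)%:C%C *: f)).
by rewrite repK //; split=> //; rewrite -{1}(repVK f' Gg) Ef; exact: inv'.
Qed.

(** The action rescales the boundary form, so it preserves orthogonal complements of invariant
    graphs. *)
Lemma graph_invariant_adjoint A : graph_invariant A -> graph_invariant (adjoint ip A).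
Proof.
move=> invA g q Gg /adjointP Aq; apply/adjointP => p Ap.
rewrite -(graph_actK p Gg) bform_graph_act // Aq ?mulr0 //.
by apply: invA => //; exact: aff_inv_mem.
Qed.

End AffineAction.

(** * Semi-bounded operators; the sign [s] covers lower and upper bounds at once *)

Section SemiboundedOperators.
Variables (R : realType) (H : lmodType R[i]) (ip : H -> H -> R[i]).
Hypothesis hip : inner_product ip.
Hypothesis complH : forall u, cauchy ip u -> exists x, converges ip u x.
Variable A : operator H.
Hypotheses (A_closed : closed_op ip A) (A_sym : symmetric_op ip A).
Variables s m : R.
Hypothesis s_unit : `|s| = 1.
Hypothesis A_bounded : forall f h, A (f, h) -> m * hnorm ip f ^+ 2 <= s * complex.Re (ip h f).

(* Otherwise [A - l] would be onto, hence [A] self-adjoint, without deficiency vectors. *)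
Lemma real_deficiency_vector (v : H) (l : R) :
  v <> 0 -> adjoint ip A (v, 'i%C *: v) -> s * l < m ->
  exists e, e <> 0 /\ adjoint ip A (e, l%:C%C *: e).
Proof.
move=> v0 Av lm; have [Aop [_ AA]] := A_sym.
apply: contrapT => noe.
have ker0 e : adjoint ip A (e, l%:C%C *: e) -> e = 0.
  by move=> Ae; apply: contrapT => e0; apply: noe; exists e.
have delta0 : 0 < m - s * l by rewrite subr_gt0.
have low f h : A (f, h) -> (m - s * l) * hnorm ip f <= hnorm ip (h - l%:C%C *: f).
  move=> Afh; have [f0|/eqP f0] := eqVneq f 0.
    by rewrite f0 /hnorm (ip0l hip) sqrtr0 mulr0 sqrtr_ge0.
  have nf : 0 < hnorm ip f by rewrite sqrtr_gt0; exact: rip_gt0.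
  rewrite -(ler_pM2r nf); apply: le_trans (rip_norm_le hip _ _).
  rewrite -[leRHS]mul1r -s_unit -normrM; apply: le_trans (ler_norm _).
  have := A_bounded Afh; rewrite -/(rip ip h f) -mulrA -expr2 !(sqr_hnorm hip).
  by rewrite (ripDl hip) (ripNl hip) (ripZl hip); lra.
(* Decomposing [(i - l) v] gives [w = 0] and puts [v - f] in the kernel of the adjoint minus [l], so
   [v = f] is an eigenvector of [A] for [i], against symmetry. *)
have [f [h [w [Afh Aw E]]]] := range_deficiency_decomposition hip complH
  A_closed Aop delta0 low ('i%C *: v - l%:C%C *: v).
have w0 : w = 0 by apply: ker0; move: Aw; rewrite conjc_real.
have fv : v - f = 0.
  apply: ker0; have := linear_setB (linear_adjoint hip A) Av (AA _ Afh).
  suff -> : l%:C%C *: (v - f) = 'i%C *: v - h by [].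
  have -> : 'i%C *: v = ('i%C *: v - l%:C%C *: v) + l%:C%C *: v by rewrite subrK.
  by rewrite E w0; lmod R[i].
have vf : v = f by apply/eqP; rewrite -subr_eq0 fv.
have hv : h = 'i%C *: v.
  have -> : 'i%C *: v = ('i%C *: v - l%:C%C *: v) + l%:C%C *: v by rewrite subrK.
  by rewrite E w0 -vf; lmod R[i].
have := symmetric_Im hip A_sym Afh.
rewrite hv -vf (ipZl hip) (ip_rip hip) /= mul0r mul1r add0r.
by apply/eqP; rewrite gt_eqF // rip_gt0.
Qed.

Variables (G : set (R * R)) (U : R * R -> H -> H).
Hypotheses (hG : affine_subgroup G) (hU : unitary_rep ip G U).
Hypothesis all_invariant :
  forall L, intermediate A (adjoint ip A) L -> graph_invariant G U L.

Lemma not_bounded_of_all_invariant (v : H) :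
  v <> 0 -> adjoint ip A (v, 'i%C *: v) -> ~ nontrivial_group G.
Proof.
move=> v0 Av [[a b] [Gg ne]]; have /= a0 := affine_pos hG Gg.
have [Aop [_ AA]] := A_sym; have HA := linear_operator Aop.
have HA' := linear_adjoint hip A.
have ss : s * s = 1 by rewrite -expr2 -real_normK ?num_real // s_unit expr1n.
(* Every [t < t0] makes both [mu = s * t] and its image satisfy the bound. An affine map fixing two
   points is the identity, so one of the candidates at [t0 - 1] and [t0 - 2] is moved. *)
have [mu [mum lm neq]] : exists mu : R, [/\ s * mu < m, s * (a * mu + b) < m & a * mu + b <> mu].
  pose t0 := Num.min m ((m - s * b) / a).
  have t0m : t0 <= m by rewrite ge_min lexx.
  have at0 : a * t0 <= m - s * b by rewrite mulrC -ler_pdivlMr // ge_min lexx orbT.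
  have good t : t < t0 -> s * (s * t) < m /\ s * (a * (s * t) + b) < m.
    move=> tt; rewrite mulrA ss mul1r; split; first exact: lt_le_trans t0m.
    rewrite mulrDr mulrCA mulrA mulrA -[a * s * s]mulrA ss mulr1.
    by rewrite -ltrBrDr; apply: lt_le_trans at0; rewrite ltr_pM2l.
  have [g1 g2] := good (t0 - 1) ltac:(lra); have [g3 g4] := good (t0 - 2) ltac:(lra).
  have [E1|] := eqVneq (a * (s * (t0 - 1)) + b) (s * (t0 - 1)); last first.
    by move=> /eqP; exists (s * (t0 - 1)).
  have [E2|] := eqVneq (a * (s * (t0 - 2)) + b) (s * (t0 - 2)); last first.
    by move=> /eqP; exists (s * (t0 - 2)).
  have a1 : a = 1.
    have : (a - 1) * s = 0 by move: E1 E2; rewrite !mulrBr !mulr1; lra.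
    move=> /eqP; rewrite mulf_eq0 subr_eq0 => /orP[/eqP //|/eqP s0].
    by move: s_unit; rewrite s0 normr0 => /eqP; rewrite eq_sym oner_eq0.
  by case: ne; rewrite a1; congr pair; move: E1; rewrite a1 mul1r; lra.
pose l := a * mu + b.
have [e [e0 Ae]] := real_deficiency_vector v0 Av lm.
pose E : H * H := (e, l%:C%C *: e); rewrite -/E in Ae.
pose L := [set p | exists (c : R[i]) u, A u /\ p = c *: E + u].
have IL : intermediate A (adjoint ip A) L.
  split.
  - split; first by exists 0, 0; split; [case: HA|rewrite scale0r addr0].
    move=> c p q [cp [up [Ap ->]]] [cq [uq [Aq ->]]].
    exists (c * cp + cq), (c *: up + uq); split; first by case: HA => _; apply.
    by lmod R[i].
  - by move=> u Au; exists 0, u; split=> //; rewrite scale0r add0r.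
  - by move=> _ [c [u [Au ->]]]; case: HA' => _; apply=> //; exact: AA.
have [c [u [Au Eu]]] : L (graph_act U (a, b) E).
  by apply: all_invariant => //; exists 1, 0; split; [case: HA|rewrite scale1r addr0].
pose e' := U (a, b) e.
(* The action takes the eigenvalue [l] to [(l - b) / a], which is [mu]. *)
have Eact : graph_act U (a, b) E = (e', mu%:C%C *: e').
  rewrite /graph_act /=; congr (_, _).
  rewrite (repZ hU) // -/e' -scalerBl scalerA -rmorphB -rmorphM /=.
  by rewrite /l addrK mulKf // gt_eqF.
have EE : bform ip E E = 0 by rewrite /bform /= !(ipE hip) conjc_real subrr.
(* [E] is orthogonal, for the boundary form, to [u] and to itself, hence to its image; this reads
   [(mu - l) (e', e) = 0]. *)
have orth : ip e' e = 0.
  have : bform ip u E = 0 by move/adjointP: Ae; exact.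
  have -> : u = (- c) *: E + graph_act U (a, b) E by rewrite Eu; lmod R[i].
  rewrite (bformDl hip) (bformZl hip) EE mulr0 add0r Eact.
  rewrite /bform /= !(ipE hip) conjc_real -mulrBl => /eqP.
  rewrite mulf_eq0 -rmorphB fmorph_eq0 subr_eq0 => /orP[/eqP E1|/eqP //].
  by case: neq; rewrite -/l -E1.
have orth' : ip e e' = 0 by rewrite (ipC hip) orth rmorph0.
have ee' : ip e' e' = (rip ip e e)%:C%C.
  by rewrite -(ip_rip hip); case: hU => _ isom _ _; exact: isom.
have u1 : u.1 = e' - c *: e.
  by rewrite (_ : u = (- c) *: E + graph_act U (a, b) E); [rewrite Eact /=; lmod R[i]|rewrite Eu; lmod R[i]].
have u2 : u.2 = mu%:C%C *: e' - c *: (l%:C%C *: e).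
  by rewrite (_ : u = (- c) *: E + graph_act U (a, b) E); [rewrite Eact /=; lmod R[i]|rewrite Eu; lmod R[i]].
(* On [u.1 = e' - c *: e] the form splits by orthogonality, with both eigenvalues beyond the bound;
   strictness comes from [e'], whose coefficient is 1. *)
have := A_bounded (f := u.1) (h := u.2); rewrite (sqr_hnorm hip) /rip u1 u2.
rewrite !(ipE hip) orth orth' ee' (ip_rip hip e).
set n := rip ip e e; have n0 : 0 < n by exact: rip_gt0.
rewrite -u1 -u2; have Au' : A (u.1, u.2) by case: u Au {Eu u1 u2}.
move=> /(_ Au').
have k0 : 0 <= complex.Re c ^+ 2 + complex.Im c ^+ 2 by rewrite addr_ge0 ?sqr_ge0.
case: c k0 {Eu u1 u2} => x y /=; set k := x ^+ 2 + y ^+ 2 => k0.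
rewrite -/l in lm.
have h1 : 0 < (m - s * mu) * n by rewrite mulr_gt0 // subr_gt0.
have h2 : 0 <= (m - s * l) * (n * k) by rewrite mulr_ge0 ?mulr_ge0 // ?subr_ge0 ltW.
move=> le; have {le} : m * (n + n * k) <= s * (mu * n + l * (n * k)).
  by move: le; congr (is_true (_ <= _)); rewrite /k; ring.
apply/negP; rewrite -ltNge -subr_gt0.
rewrite (_ : _ - _ = (m - s * mu) * n + (m - s * l) * (n * k)); last by ring.
by rewrite ltr_wpDr.
Qed.

End SemiboundedOperators.

(** * Three invariant extensions in either case, and the conclusion *)

Theorem theorem6p3 (R : realType) (H : lmodType R[i]) (ip : H -> H -> R[i])
  (hH : separable_hilbert ip)
  (G : set (R * R)) (hG : affine_subgroup G)
  (U : R * R -> H -> H) (hU : unitary_rep ip G U)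
  (Ad : operator H)
  (hAd_closed : closed_op ip Ad) (hAd_sym : symmetric_op ip Ad)
  (hAd_inv : G_invariant G U Ad) (hAd_def : deficiency_indices_11 ip Ad)
  (hyp :
     (exists A1 A2 A3 : operator H,
        [/\ A1 <> A2, A1 <> A3 & A2 <> A3] /\
        (forall A, A = A1 \/ A = A2 \/ A = A3 ->
           [/\ extension ip Ad A, self_adjoint ip A & G_invariant G U A]))
     \/
     (exists A1 A2 : operator H,
        [/\ A1 <> A2, ~ self_adjoint ip A1 &
           forall A, A = A1 \/ A = A2 ->
             [/\ extension ip Ad A, maximal_dissipative ip A & G_invariant G U A]])) :
  (forall A : operator H, extension ip Ad A -> maximal_dissipative ip A ->
     G_invariant G U A) /\
  (nontrivial_group G -> ~ semibounded ip Ad).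
Proof.
have [hip complH _] := hH.
have [[vp [Avp [vp0 Hp]]] [vm [Avm [vm0 Hm]]]] := hAd_def.
have [Aop [_ _]] := hAd_sym; have HN := linear_operator Aop.
have sp := von_neumann_spans hip complH hAd_closed hAd_sym Hp Hm.
have invP := G_invariantP hG hU.
have all_inv : forall L, intermediate Ad (adjoint ip Ad) L -> graph_invariant G U L.
  suff [A1 [A2 [A3 [[I1 I2 I3] [i1 i2 i3] [n12 n21] [n31 n32 n13]]]]] :
      exists A1 A2 A3 : operator H,
      [/\ [/\ intermediate Ad (adjoint ip Ad) A1, intermediate Ad (adjoint ip Ad) A2
            & intermediate Ad (adjoint ip Ad) A3],
          [/\ graph_invariant G U A1, graph_invariant G U A2 & graph_invariant G U A3],
          ~ A1 `<=` A2 /\ ~ A2 `<=` A1 &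
          [/\ ~ A3 `<=` A1, ~ A3 `<=` A2 & ~ A1 `<=` A3]].
    move=> L IL g p Gg; move: p.
    apply: (intermediate_invariant HN _ _ sp I1 I2 I3) => //.
    - by move=> c p q; exact: (graph_act_linear hU).
    - by move=> p; move/invP: hAd_inv; exact.
    - by move=> p; exact: i1.
    - by move=> p; exact: i2.
    - by move=> p; exact: i3.
  case: hyp => [[A1 [A2 [A3 [[d12 d13 d23] P]]]]|[A1 [A2 [d12 nsa P]]]].
    have [[N1 M1] s1 /invP i1] := P A1 (or_introl erefl).
    have [[N2 M2] s2 /invP i2] := P A2 (or_intror (or_introl erefl)).
    have [[N3 M3] s3 /invP i3] := P A3 (or_intror (or_intror erefl)).
    have lin A : self_adjoint ip A -> linear_set A by move=> ->; exact: linear_adjoint.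
    exists A1, A2, A3; split; try by split.
    - by split; split => //; exact: lin.
    - by split=> [/(subset_self_adjoint s1 s2)|/(subset_self_adjoint s2 s1)/esym].
    - by split=> [/(subset_self_adjoint s3 s1)/esym|/(subset_self_adjoint s3 s2)/esym
                 |/(subset_self_adjoint s1 s3)].
  have [[N1 M1] [op1 [D1 max1]] /invP i1] := P A1 (or_introl erefl).
  have [[N2 M2] [op2 [D2 max2]] /invP i2] := P A2 (or_intror erefl).
  have I1 : intermediate Ad (adjoint ip Ad) A1 by split=> //; exact: linear_operator.
  have I2 : intermediate Ad (adjoint ip Ad) A2 by split=> //; exact: linear_operator.
  (* Maximality turns an inclusion between the two extensions into equality. *)
  have n12 : ~ A1 `<=` A2 by move=> /(max1 _ op2 D2) /esym.
  have n21 : ~ A2 `<=` A1 by move=> /(max2 _ op1 D1).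
  (* On the deficiency vector for [-i] the imaginary part is minus the squared norm of [vm]. *)
  have indefinite : exists p, adjoint ip Ad p /\ complex.Im (ip p.2 p.1) < 0.
    exists (vm, - ('i%C *: vm)); split=> //=.
    rewrite (ipNl hip) (ipZl hip) (ip_rip hip) /= mul0r add0r mul1r oppr_lt0.
    exact: rip_gt0.
  exists A1, A2, (adjoint ip A1); split=> //.
  - by split=> //; exact: intermediate_adjoint.
  - by split=> //; exact: (graph_invariant_adjoint hip hG hU).
  - exact: (adjoint_third_line hip HN sp I1 I2 D1 D2 n12 n21 indefinite nsa).
split=> [A [NA AM] [opA _]|ntG sb].
  by apply/invP; apply: all_inv; split=> //; exact: linear_operator.
have contra s m su bnd := @not_bounded_of_all_invariant _ _ _ hip complH _ hAd_closed hAd_sym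
  s m su bnd _ _ hG hU all_inv vp vp0 Avp ntG.
case: sb => [[c bnd]|[c bnd]].
  by apply: (contra 1 c); rewrite ?normr1 // => f h /bnd; rewrite mul1r.
(* An upper bound [c] is a lower bound [-c] for the negated form. *)
apply: (contra (-1) (- c)); rewrite ?normrN ?normr1 // => f h /bnd.
by rewrite mulNr mulN1r lerN2.
Qed.
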